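(* Let $2\le r_1<r_2$ be integers and let $n$ be such that $h_0:=n-5-2(r_1+r_2)\ge2$. Define on $\mathfrak{F}(n)$ the maps $\alpha([h,q_1,q_2])=[h-1,q_1+1,q_2]$ (for $h\ge3$), $\beta([h,q_1,q_2])=[h,q_1-1,q_2+1]$ (for $q_1\ge3$), and $\gamma([h,q_1,q_2])=[h-1,q_1,q_2+1]$ (for $h\ge3$). Let $T^*=[h_0,2,2]$. Then: (a) for each $T$ in the domain of $\alpha$ (resp. $\beta$, $\gamma$), the tree $\alpha(T)$ (resp. $\beta(T)$, $\gamma(T)$) is obtained from $T$ by a 2-switch; (b) $\rho(\alpha(T))<\rho(T)$, $\rho(\beta(T))<\rho(T)$ and $\rho(\gamma(T))<\rho(T)$ whenever defined; (c) every $T\in\mathfrak{F}(n)$ can be obtained from $T^*$ by a sequence of applications of $\alpha$ and $\beta$; (d) every $T\in\mathfrak{F}(n)$ can be obtained from $T^*$ by a sequence of applications of $\alpha$ and $\gamma$.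
   Context: $\rho(G)$ denotes the spectral radius (largest eigenvalue of the adjacency matrix) of a graph $G$. For integers $h,q_1,q_2\ge 2$ and fixed integers $2\le r_1<r_2$, the tree $[h,q_1,q_2]$ is constructed as follows: take a vertex $u$; attach to $u$ a pendant path with $h$ edges; attach to $u$ a path with $q_1$ edges ending at a vertex $v_1$, and attach to $v_1$ exactly $r_1$ pendant paths with $2$ edges each; attach to $u$ a path with $q_2$ edges ending at a vertex $v_2$, and attach to $v_2$ exactly $r_2$ pendant paths with $2$ edges each. It has $n=1+h+q_1+q_2+2(r_1+r_2)$ vertices. $\mathfrak{F}(n)$ is the set of all such trees $[h,q_1,q_2]$ with $h,q_1,q_2\ge2$ and $h+q_1+q_2=n-1-2(r_1+r_2)$. A 2-switch in a graph $G$ with distinct vertices $a,b,c,d$ such that $ab,cd\in E(G)$ and $ac,bd\notin E(G)$ consists of deleting $ab,cd$ and adding $ac,bd$. *)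

(* Defs.v *)
From HB Require Import structures.
From mathcomp Require Import all_boot all_order all_algebra.
From mathcomp Require Import fingroup perm classical_sets reals.
From Stdlib Require Import Relations.
Unset Printing Implicit Defensive.
Import Order.TTheory GRing.Theory Num.Theory.

(* adjacency matrix of a graph given by an (assumed symmetric, irreflexive) relation *)
Definition adjmx {R : realType} {n : nat} (G : rel 'I_n) : 'M[R]_n :=
  \matrix_(i, j) ((G i j)%:R)%R.

Definition rho (R : realType) {n : nat} (G : rel 'I_n) : R :=
  sup [set a : R | eigenvalue (adjmx G : 'M[R]_n) a].

Definition upair {T : eqType} (x y a b : T) : bool :=
  ((x == a) && (y == b)) || ((x == b) && (y == a)).

Definition two_switch {T : finType} (G G' : rel T) : Prop :=
  exists a b c d : T,
    uniq [:: a; b; c; d] /\ G a b /\ G c d /\ ~~ G a c /\ ~~ G b d /\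
    forall x y, G' x y =
      (G x y && ~~ upair x y a b && ~~ upair x y c d)
      || upair x y a c || upair x y b d.

Definition isomorphic {T : finType} (G H : rel T) : Prop :=
  exists s : {perm T}, forall x y, H (s x) (s y) = G x y.

Definition obtained_by_2switch {T : finType} (G H : rel T) : Prop :=
  exists G' : rel T, two_switch G G' /\ isomorphic G' H.

(* directed edges of a path with [len] edges hanging from vertex [s], using the
   new vertices st, st+1, ..., st+len-1 (in that order) *)
Definition path_e (s st len : nat) (x y : nat) : bool :=
  ((x == s) && (y == st) && (0 < len)) ||
  ((st <= x) && (y == x.+1) && (y < st + len)).

Definition pendants_e (v st r : nat) (x y : nat) : bool :=
  has (fun k => path_e v (st + 2 * k) 2 x y) (iota 0 r).

(* Vertex numbering: u = 0; pendant path 1..h; path to v1: h+1..h+q1 (v1 = h+q1);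
   r1 pendant P3's at v1: h+q1+1 .. h+q1+2r1; path to v2: B+1..B+q2 with
   B = h+q1+2r1 (v2 = B+q2); r2 pendant P3's at v2: B+q2+1 .. B+q2+2r2. *)
Definition tree_e (r1 r2 h q1 q2 : nat) (x y : nat) : bool :=
  let v1 := h + q1 in
  let B := h + q1 + 2 * r1 in
  let v2 := B + q2 in
  [|| path_e 0 1 h x y, path_e 0 (h + 1) q1 x y, pendants_e v1 (v1 + 1) r1 x y,
      path_e 0 (B + 1) q2 x y | pendants_e v2 (v2 + 1) r2 x y].

Definition tree_graph (n r1 r2 : nat) (t : nat * nat * nat) : rel 'I_n :=
  fun i j => let: (h, q1, q2) := t in
    tree_e r1 r2 h q1 q2 i j || tree_e r1 r2 h q1 q2 j i.

Definition inF (n r1 r2 : nat) (t : nat * nat * nat) : bool :=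
  let: (h, q1, q2) := t in
  [&& 2 <= h, 2 <= q1, 2 <= q2 & 1 + h + q1 + q2 + 2 * (r1 + r2) == n].

Definition alpha (t : nat * nat * nat) : nat * nat * nat :=
  let: (h, q1, q2) := t in (h.-1, q1.+1, q2).
Definition beta (t : nat * nat * nat) : nat * nat * nat :=
  let: (h, q1, q2) := t in (h, q1.-1, q2.+1).
Definition gamma (t : nat * nat * nat) : nat * nat * nat :=
  let: (h, q1, q2) := t in (h.-1, q1, q2.+1).

Definition dom_alpha (t : nat * nat * nat) : bool := 3 <= t.1.1.
Definition dom_beta (t : nat * nat * nat) : bool := 3 <= t.1.2.
Definition dom_gamma (t : nat * nat * nat) : bool := 3 <= t.1.1.

Definition step_ab (t t' : nat * nat * nat) : Prop :=
  (dom_alpha t /\ t' = alpha t) \/ (dom_beta t /\ t' = beta t).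
Definition step_ag (t t' : nat * nat * nat) : Prop :=
  (dom_alpha t /\ t' = alpha t) \/ (dom_gamma t /\ t' = gamma t).

(* Main.v *)
(** Write [x] for the Perron vector of a tree [T] with root [u] and [a = rho T].
    Each of the three moves detaches a child [c] of [u] from its only child [b],
    hangs [b] at [u], and moves another child [d] of [u] below [c].  With [e] the
    third child of [u], scale [x] by [x u / x c] on the branch of [b], by
    [x u / (x c + x e)] on the branch of [d], and change its value at [c]; the
    result satisfies the eigenvalue equation of [a] in the new tree everywhere
    except at [u], where there is a deficit exactly when
    [x c * (x c + x e) < (x u)^2].  Pairing with the Perron vector of the new tree
    shows that the spectral radius decreases.  The inequality follows from
    estimates of the ratios of consecutive entries of [x] along the paths,
    compared with the root [s < 1] of [s + 1/s = a]; the move [beta] needs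
    [r1 < r2], through [a^2 - 1 >= r2 + 1]. *)
From Stdlib Require Import Relations.
Require Import Defs.
From HB Require Import structures.
From mathcomp Require Import all_boot all_order all_algebra.
From mathcomp Require Import fingroup perm.
From mathcomp Require Import classical_sets reals.
From mathcomp Require Import boolp topology normedtype derive.
From mathcomp Require Import zify ring lra.
Set Implicit Arguments.
Unset Strict Implicit.
Import Order.TTheory GRing.Theory Num.Theory.
Import numFieldNormedType.Exports.
Local Open Scope ring_scope.

(** * The spectral radius as a maximum of the quadratic form *)

Definition dotr {R : realType} {n : nat} (u v : 'rV[R]_n) : R :=
  \sum_i u 0 i * v 0 i.

Section Dot.
Local Open Scope classical_set_scope.
Local Open Scope ring_scope.
Variables (R : realType) (n : nat).
Implicit Types (u v w : 'rV[R]_n) (A : 'M[R]_n) (a : R).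

Lemma dotrC u v : dotr u v = dotr v u.
Proof. by apply: eq_bigr => i _; rewrite mulrC. Qed.

Lemma dotrDl u v w : dotr (u + v) w = dotr u w + dotr v w.
Proof. by rewrite -big_split; apply: eq_bigr => i _; rewrite mxE mulrDl. Qed.

Lemma dotrZl a u v : dotr (a *: u) v = a * dotr u v.
Proof. by rewrite mulr_sumr; apply: eq_bigr => i _; rewrite mxE mulrA. Qed.

Lemma dotrDr u v w : dotr u (v + w) = dotr u v + dotr u w.
Proof. by rewrite dotrC dotrDl dotrC (dotrC w). Qed.

Lemma dotrZr a u v : dotr u (a *: v) = a * dotr u v.
Proof. by rewrite dotrC dotrZl dotrC. Qed.

Lemma dotr0l u : dotr 0 u = 0.
Proof. by rewrite /dotr big1 // => i _; rewrite mxE mul0r. Qed.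

Lemma dotr_ge0 u : 0 <= dotr u u.
Proof. by apply: sumr_ge0 => i _; rewrite -expr2 sqr_ge0. Qed.

Lemma dotr_eq0 u : dotr u u = 0 -> u = 0.
Proof.
move=> /eqP; rewrite psumr_eq0 => [/allP u0|i _]; last by rewrite -expr2 sqr_ge0.
apply/rowP => i; rewrite mxE; apply/eqP.
by have /= := u0 i (mem_index_enum i); rewrite mulf_eq0 orbb.
Qed.

Lemma dotr_gt0 u : u != 0 -> 0 < dotr u u.
Proof.
move=> u0; rewrite lt_neqAle dotr_ge0 andbT eq_sym.
by apply: contra_neq u0; exact: dotr_eq0.
Qed.

Lemma dotr_mulmx_sym A u v : A^T = A -> dotr (u *m A) v = dotr (v *m A) u.
Proof.
move=> symA; have E x y : dotr x y = (x *m y^T) 0 0.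
  by rewrite mxE; apply: eq_bigr => i _; rewrite !mxE.
rewrite !E; transitivity ((u *m A *m v^T)^T 0 0); first by rewrite [RHS]mxE.
by rewrite !trmx_mul trmxK symA mulmxA.
Qed.

(** A positive semidefinite form that vanishes at [v] is stationary there: moving from [v] against
    the gradient direction [v *m A] would make it negative unless that direction is zero. *)
Lemma psd_isotropic A v : A^T = A ->
  (forall w, 0 <= dotr (w *m A) w) -> dotr (v *m A) v = 0 -> v *m A = 0.
Proof.
move=> symA psd v0; apply: dotr_eq0.
set w := v *m A; set a := dotr w w; set c := dotr (w *m A) w.
have c0 : 0 <= c by apply: psd.
(* With [t = a / (c + 1)] the value at [v - t w] is [- 2 t a + t^2 c = - t^2 (c + 2)], which forces
   [t = 0]. The [+ 1] keeps the denominator positive when [c = 0]. *)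
have /= := psd (v + (- (a / (c + 1))) *: w).
rewrite mulmxDl -scalemxAl !dotrDl !dotrDr !dotrZl !dotrZr v0 -/w.
rewrite (dotr_mulmx_sym w v) // -/w -/a -/c.
set t := a / (c + 1); have ta : a = t * (c + 1) by rewrite /t divfK // gt_eqF // ltr_wpDl.
have : 0 <= t ^+ 2 by apply: sqr_ge0.
move=> t2 h; have t20 : t ^+ 2 = 0.
  by clear -c0 ta t2 h; clearbody a c t; subst a; nra.
by move/eqP: t20; rewrite sqrf_eq0 => /eqP t0; rewrite ta t0 mul0r.
Qed.

Lemma continuous_sumr (T : topologicalType) (I : finType) (f : I -> T -> R) :
  (forall i, continuous (f i)) -> continuous (fun x => \sum_i f i x).
Proof.
move=> cf; elim: (index_enum I) => [|i s IH] x.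
  under eq_fun do rewrite big_nil.
  exact: cst_continuous.
under eq_fun do rewrite big_cons.
by apply: cvgD; [exact: cf | exact: IH].
Qed.

Lemma continuous_mulr (T : topologicalType) (f g : T -> R) :
  continuous f -> continuous g -> continuous (fun x => f x * g x).
Proof. by move=> cf cg x; apply: cvgM; [exact: cf | exact: cg]. Qed.

Lemma continuous_dotr_mulmx A : continuous (fun w : 'rV[R]_n => dotr (w *m A) w).
Proof.
apply: continuous_sumr => i; apply: continuous_mulr; last exact: coord_continuous.
have -> : (fun w : 'rV_n => (w *m A) 0 i) = (fun w => \sum_j w 0 j * A j i).
  by apply/funext => w; rewrite mxE.
apply: continuous_sumr => j.
by apply: continuous_mulr; [exact: coord_continuous | exact: cst_continuous].
Qed.

(** The unit sphere is a closed subset of the cube with sides [[-1, 1]]. *)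
Lemma dotr_sphere_compact : compact [set w : 'rV[R]_n | dotr w w = 1].
Proof.
have box : compact [set w : 'rV[R]_n | forall i, w ord0 i \in `[-1, 1]].
  by apply: (@rV_compact R n (fun=> `[-1, 1]%classic)) => _; exact: segment_compact.
apply: subclosed_compact box _ => [|w /= w1 i].
  have -> : [set w : 'rV[R]_n | dotr w w = 1] =
            (fun w => dotr (w *m 1%:M) w) @^-1` [set x | x = 1].
    by apply/seteqP; split=> w /=; rewrite mulmx1.
  apply: preimage_closed; last exact: closed_eq.
  by move=> w _; exact: continuous_dotr_mulmx.
have : w 0 i ^+ 2 <= 1.
  rewrite -w1 /dotr (bigD1 i) //= -expr2 lerDl sumr_ge0 // => j _.
  by rewrite -expr2 sqr_ge0.
by rewrite in_itv /= => h; apply/andP; split; nra.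
Qed.

End Dot.

(** The maximum on the unit sphere exists by compactness, and homogeneity of degree two carries the
    bound to every vector. *)
Lemma rayleigh_max (R : realType) (n : nat) (A : 'M[R]_n.+1) :
  exists2 v : 'rV[R]_n.+1, dotr v v = 1 &
    forall w, dotr (w *m A) w <= dotr (v *m A) v * dotr w w.
Proof.
have [||] := @EVT_max_rV R n.+1 (fun w => dotr (w *m A) w) _ _ (@dotr_sphere_compact R n.+1).
- exists (delta_mx 0 0); rewrite /= /dotr (bigD1 0) //= big1 => [|i i0].
    by rewrite !mxE !eqxx mulr1 addr0.
  by rewrite !mxE (negbTE i0) andbF mulr0.
- by apply: continuous_subspaceT; exact: continuous_dotr_mulmx.
move=> v; rewrite inE /= => v1 vmax; exists v => // w.
have [->|w0] := eqVneq w 0; first by rewrite mul0mx dotr0l mulr0.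
have ww := dotr_gt0 w0.
set r := Num.sqrt (dotr w w); have r0 : 0 < r by rewrite sqrtr_gt0.
have rr : r * r = dotr w w by rewrite -expr2 sqr_sqrtr // ltW.
have : dotr ((r^-1 *: w) *m A) (r^-1 *: w) <= dotr (v *m A) v.
  apply: vmax; rewrite inE /= dotrZl dotrZr -rr.
  by field; rewrite gt_eqF.
by rewrite -scalemxAl dotrZl dotrZr mulrA -invfM rr ler_pdivrMl // mulrC.
Qed.

(** If [v] maximises the quadratic form with value [M], so does the vector [x] of absolute values,
    since the matrix is entrywise nonnegative. Then [x] is isotropic for the semidefinite matrix
    [M%:M - A], hence an eigenvector for [M]. As [M] also bounds every eigenvalue, the supremum in
    [rho] is [M]. *)
Lemma perron (R : realType) (n : nat) (G : rel 'I_n) :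
  (0 < n)%N -> symmetric G ->
  exists2 x : 'rV[R]_n, x *m adjmx G = rho R G *: x &
    x != 0 /\ forall i, 0 <= x 0 i.
Proof.
case: n G => // n G _ symG; set A : 'M[R]_n.+1 := adjmx G.
have symA : A^T = A by apply/matrixP=> i j; rewrite !mxE symG.
have [v v1 vmax] := rayleigh_max A; set M := dotr (v *m A) v in vmax.
pose B := M%:M - A.
have symB : B^T = B by rewrite linearB /= tr_scalar_mx symA.
have BE w : dotr (w *m B) w = M * dotr w w - dotr (w *m A) w.
  by rewrite mulmxBr mul_mx_scalar -scaleN1r dotrDl !dotrZl mulN1r.
have psdB w : 0 <= dotr (w *m B) w by rewrite BE subr_ge0.
have eigB w : dotr (w *m B) w = 0 -> w *m A = M *: w.
  move=> /(psd_isotropic symB psdB) /eqP.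
  by rewrite mulmxBr mul_mx_scalar subr_eq0 => /eqP <-.
pose x := map_mx Num.norm v.
have x1 : dotr x x = 1.
  by rewrite -v1; apply: eq_bigr => i _; rewrite !mxE -normrM ger0_norm // -expr2 sqr_ge0.
have xA : M <= dotr (x *m A) x.
  apply: ler_sum => i _; rewrite !mxE !mulr_suml; apply: ler_sum => j _.
  rewrite !mxE (le_trans (ler_norm _)) // !normrM ler_wpM2r // ler_wpM2l //.
  by rewrite normr_nat.
have xM : x *m A = M *: x.
  by apply: eigB; apply/eqP; rewrite eq_le psdB andbT BE x1 mulr1 subr_le0.
have x0 : x != 0.
  by apply: contra_eq_neq x1 => ->; rewrite dotr0l eq_sym oner_eq0.
have eigM a : eigenvalue A a -> a <= M.
  move=> /eigenvalueP [w wa w0]; have := vmax w.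
  by rewrite wa dotrZl ler_pM2r // dotr_gt0.
have Meig : eigenvalue A M by apply/eigenvalueP; exists x.
have -> : rho R G = M.
  apply/eqP; rewrite eq_le; apply/andP; split.
    by apply: ge_sup; [exists M | exact: eigM].
  by apply: ub_le_sup => //; exists M; exact: eigM.
by exists x => //; split => // i; rewrite mxE.
Qed.

(** * Perron vectors of rooted trees *)

(** A tree with root [0] is given by its parent function: each [j > 0] stands for the edge from [j]
    to [par j]. Moving a branch then changes a single value of [par]. *)
Definition tree_adj (par : nat -> nat) : rel nat :=
  fun i j => (0 < j)%N && (i == par j) || (0 < i)%N && (j == par i).

Definition tree_rel (n : nat) (par : nat -> nat) : rel 'I_n :=
  fun i j => tree_adj par i j.

Definition rooted (n : nat) (par : nat -> nat) : Prop :=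
  forall j, (0 < j < n)%N -> (par j < j)%N.

(** The eigenvalue equation at each vertex, with the neighbours split into the parent and the
    children. Vectors are functions on [nat], so that labels can be computed with freely. *)
Definition tree_eigen {R : realType} (n : nat) (par : nat -> nat) (a : R)
    (X : nat -> R) : Prop :=
  forall i, (i < n)%N ->
    a * X i = (if (0 < i)%N then X (par i) else 0)
              + \sum_(j < n | (0 < j)%N && (par j == i)) X j.

Section Trees.
Variables (R : realType) (n : nat).
Implicit Types (par : nat -> nat) (X : nat -> R) (a : R).

Lemma tree_relC par : symmetric (@tree_rel n par).
Proof. by move=> i j; rewrite /tree_rel /tree_adj orbC. Qed.

Lemma rooted_lt par j : rooted n par -> (j < n)%N -> (0 < j)%N -> (par j < n)%N.
Proof. by move=> rp jn j0; have := rp j; rewrite j0 jn => /(_ isT); lia. Qed.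

Lemma tree_eigen_exists par : (0 < n)%N -> rooted n par ->
  exists2 X, tree_eigen n par (rho R (@tree_rel n par)) X &
    (forall i, 0 <= X i) /\ exists2 i, (i < n)%N & X i != 0.
Proof.
move=> n0 rp; have [x xA [x0 xge0]] := perron R n0 (@tree_relC par).
(* The value [0] beyond the labels keeps [X] nonnegative at every natural number. *)
pose X k := if insub k is Some i then x 0 i else 0.
have XE (i : 'I_n) : X i = x 0 i by rewrite /X valK.
exists X; last split.
- move=> i ilt; set k := Ordinal ilt.
  have /rowP /(_ k) := xA; rewrite [in RHS]mxE -XE => <-; rewrite mxE.
  rewrite (bigID (fun j : 'I_n => (0 < j)%N && (par j == i))) /= addrC.
  congr (_ + _); last first.
    apply: eq_bigr => j ji; rewrite mxE /tree_rel /tree_adj XE /=.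
    by case/andP: ji => -> /eqP ->; rewrite eqxx orbT mulr1.
  case: ltnP => i0.
    have pi : (par i < n)%N by apply: rooted_lt.
    rewrite (bigD1 (Ordinal pi)) /=.
      rewrite mxE /tree_rel /tree_adj /= i0 eqxx mulr1 -XE big1 ?addr0 //.
      move=> j /andP [jni jp]; rewrite mxE /tree_rel /tree_adj /= i0.
      by rewrite -val_eqE /= in jp; rewrite (negbTE jp) [i == _]eq_sym (negbTE jni) mulr0.
    by have := rp i; have := rp (par i); lia.
  rewrite big1 // => j jni; rewrite mxE /tree_rel /tree_adj /= [i == _]eq_sym (negbTE jni).
  by rewrite ltnNge i0 mulr0.
- by move=> i; rewrite /X; case: insub.
- have [/existsP [i xi]|/existsPn xz] := boolP [exists i, x 0 i != 0].
    by exists i; rewrite ?XE.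
  by case/eqP: x0; apply/rowP => i; rewrite mxE; apply/eqP; have := xz i; rewrite negbK.
Qed.

(** By nonnegativity, a zero entry forces zeros at the parent and at all children. One zero thus
    spreads down to the root and from there to the whole tree. *)
Lemma tree_eigen_gt0 par a X : rooted n par -> tree_eigen n par a X ->
  (forall i, 0 <= X i) -> (exists2 i, (i < n)%N & X i != 0) ->
  forall i, (i < n)%N -> 0 < X i.
Proof.
move=> rp eX X0 [k kn Xk] i ilt; rewrite lt_neqAle X0 andbT eq_sym.
apply: contraNneq Xk => Xi.
have nbr j : (j < n)%N -> X j = 0 -> [/\ (0 < j)%N -> X (par j) = 0 &
    forall l, (l < n)%N -> (0 < l)%N -> par l = j -> X l = 0].
  move=> jn Xj; have := eX j jn; rewrite Xj mulr0 => /esym/eqP.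
  have s0 : 0 <= \sum_(l < n | (0 < l)%N && (par l == j)) X l by apply: sumr_ge0.
  rewrite paddr_eq0 //; last by case: ifP.
  rewrite psumr_eq0 // => /andP [/eqP p0 /allP c0]; split=> [j0|l ln l0 pl].
    by rewrite j0 in p0.
  have /= := c0 (Ordinal ln) (mem_index_enum _).
  by rewrite l0 pl eqxx /= => /eqP.
have root0 : X 0%N = 0.
  elim/ltn_ind: i ilt Xi => i IH ilt Xi; case: (posnP i) => [i00|i0]; first by rewrite -i00.
  have [/(_ i0) Xp _] := nbr i ilt Xi; apply: IH Xp; first by rewrite rp // i0.
  exact: rooted_lt.
elim/ltn_ind: k kn => l IH ln; case: (posnP l) => [->|l0]; first by rewrite root0.
have pl : (par l < l)%N by rewrite rp // l0.
have pn := ltn_trans pl ln; have [_ ch] := nbr _ pn (eqP (IH _ pl pn)).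
by rewrite (ch l).
Qed.

(** Pairing the eigenvalue equation with [phi] and collecting terms edge by edge, each edge being
    indexed by its lower end, makes two trees that share most of their edges comparable term by
    term. *)
Lemma tree_edge_sum par a X (phi : nat -> R) : rooted n par -> tree_eigen n par a X ->
  a * (\sum_(i < n) phi i * X i) =
  \sum_(j < n | (0 < j)%N) (phi j * X (par j) + phi (par j) * X j).
Proof.
move=> rp eX; rewrite mulr_sumr.
under eq_bigr => i _ do rewrite mulrCA eX // mulrDr.
rewrite big_split /= [RHS]big_split /=; congr (_ + _).
  rewrite [RHS]big_mkcond; apply: eq_bigr => i _.
  by case: ifP; rewrite ?mulr0.
under eq_bigr => i _ do rewrite mulr_sumr.
rewrite (exchange_big_dep (fun j : 'I_n => (0 < j)%N)) /=; last by move=> i j _ /andP [].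
apply: eq_bigr => j j0; have pj := rooted_lt rp (ltn_ord j) j0.
rewrite (big_pred1 (Ordinal pj)) // => i.
by rewrite j0 eq_sym.
Qed.

Lemma tree_perron par : (0 < n)%N -> rooted n par ->
  exists2 X, tree_eigen n par (rho R (@tree_rel n par)) X &
    forall i, (i < n)%N -> 0 < X i.
Proof.
move=> n0 rp; have [X eX [X0 Xn]] := tree_eigen_exists n0 rp.
by exists X => //; apply: tree_eigen_gt0 eX X0 Xn.
Qed.

End Trees.

(** * Comparison of spectral radii before and after a switch *)

(* The parent function after replacing the edges [bc], [d0] by [b0], [cd]. *)
Definition switch_par (par : nat -> nat) (b c d j : nat) : nat :=
  if j == b then 0%N else if j == d then c else par j.

(* [Db] and [Dd] are the branches hanging from [b] and from [d]. *)
Record switchable (n : nat) (par : nat -> nat) (b c d : nat) (Db Dd : pred nat)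
    : Prop := Switchable {
  sw_rooted : rooted n par;
  sw_bn : (b < n)%N;
  sw_dn : (d < n)%N;
  sw_c0 : (0 < c)%N;
  sw_cb : (c < b)%N;
  sw_cd : (c < d)%N;
  sw_bd : b != d;
  sw_pb : par b = c;
  sw_pc : par c = 0%N;
  sw_pd : par d = 0%N;
  sw_child : forall j, (0 < j < n)%N -> par j = c -> j = b;
  sw_D0 : ~~ Db 0%N && ~~ Dd 0%N;
  sw_Db : Db b;
  sw_Dd : Dd d && ~~ Db d;
  sw_D : forall j, (0 < j < n)%N -> j != b -> j != c -> j != d ->
    (Db j = Db (par j)) /\ (Dd j = Dd (par j))
}.

Lemma switch_rooted n par b c d Db Dd :
  switchable n par b c d Db Dd -> rooted n (switch_par par b c d).
Proof.
case=> rp bn dn c0 cb cd bd pb pc pd ch _ _ _ _ j j0n; rewrite /switch_par.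
case: eqP => [->|_]; first by lia.
by case: eqP => [->|_]; [lia | exact: rp].
Qed.

Lemma sum_ordD3 (R : realType) n (P : pred nat) (F : nat -> R) (b c d : nat) :
  (b < n)%N -> (c < n)%N -> (d < n)%N -> P b -> P c -> P d ->
  b != c -> b != d -> c != d ->
  \sum_(j < n | P j) F j =
  F b + (F c + (F d +
    \sum_(j < n | P j && [&& (j != b :> nat), (j != c :> nat) & (j != d :> nat)]) F j)).
Proof.
move=> bn cn dn Pb Pc Pd bc bd cd.
rewrite (bigD1 (Ordinal bn)) //=; congr (_ + _).
rewrite (bigD1 (Ordinal cn)) /=; last by rewrite Pc -val_eqE eq_sym.
congr (_ + _); rewrite (bigD1 (Ordinal dn)) /=; last first.
  by rewrite Pd -!val_eqE /= eq_sym bd eq_sym.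
by congr (_ + _); apply: eq_bigl => j; rewrite -!val_eqE /= -!andbA.
Qed.

Lemma switch_rho_lt (R : realType) n par b c d e Db Dd (a : R) (X : nat -> R) :
  switchable n par b c d Db Dd -> (e < n)%N ->
  a = rho R (@tree_rel n par) -> tree_eigen n par a X ->
  (forall i, (i < n)%N -> 0 < X i) ->
  a * X 0%N = X c + X d + X e -> a * X c = X 0%N + X b ->
  X c * (X c + X e) < X 0%N ^+ 2 ->
  rho R (@tree_rel n (switch_par par b c d)) < a.
Proof.
move=> sw en _ eX X0 eq0 eqc ineq.
have rp' := switch_rooted sw.
case: sw => rp bn dn c0 cb cd bd pb pc pd ch D0 hDb hDd D.
have cn : (c < n)%N by lia.
have n0 : (0 < n)%N by lia.
have b0 : (0 < b)%N by lia.
have d0 : (0 < d)%N by lia.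
have bc : b != c by lia.
have dc : c != d by lia.
have cE : (0%N == c) = false by lia.
have db : (d == b) = false by lia.
have cb' : (c == b) = false by lia.
have [Y eY Y0] := @tree_perron R n _ n0 rp'.
set a' := rho R _ in eY *; set par' := switch_par par b c d in eY rp'.
(* The factor [k] preserves the equation at [b], whose parent value changes from [X c] to [X 0]. The
   factor [s], with the value [s * X 0] at [c], preserves the equation at [d] and creates the one at
   [c]. *)
pose k := X 0%N / X c; pose s := X 0%N / (X c + X e).
have Xc := X0 c cn; have Xe := X0 e en; have Xr := X0 _ n0.
have Xd := X0 d dn; have Xb := X0 b bn.
have Yc := Y0 c cn; have Yr := Y0 _ n0.
have k0 : 0 < k by rewrite divr_gt0.
have s0 : 0 < s by rewrite divr_gt0 ?addr_gt0.
have kc : k * X c = X 0%N by rewrite divfK // gt_eqF.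
have se : s * (X c + X e) = X 0%N by rewrite divfK // gt_eqF // addr_gt0.
pose m j := if Db j then k else if Dd j then s else 1.
have m0 j : 0 < m j by rewrite /m; case: ifP => //; case: ifP.
have m_root : m 0%N = 1 by rewrite /m; case/andP: D0 => /negbTE -> /negbTE ->.
have m_b : m b = k by rewrite /m hDb.
have m_d : m d = s by rewrite /m; case/andP: hDd => -> /negbTE ->.
(* [psi] is the candidate on the new tree, to be paired with [Y]; [phi] puts the same weights on [Y]
   for the pairing with [X] on the old tree. Away from [c] both pairings give [S]; at [c], where
   [psi] is not a rescaling chosen through [m], [phi] vanishes. *)
pose psi j := if j == c then s * X 0%N else m j * X j.
pose phi j := if j == c then 0 else m j * Y j.
pose S := \sum_(i < n | i != c :> nat) m i * X i * Y i.
have S0 : 0 <= S.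
  by apply: sumr_ge0 => i _; rewrite !mulr_ge0 // ltW // ?X0 ?Y0.
have sumE (f g : nat -> R) : \sum_(i < n) f i * g i =
    f c * g c + \sum_(i < n | i != c :> nat) f i * g i.
  by rewrite (bigD1 (Ordinal cn)) //=.
have E1 := tree_edge_sum phi rp eX.
have E2 := tree_edge_sum psi rp' eY.
rewrite sumE {1}/phi eqxx mul0r add0r in E1.
rewrite sumE {1}/psi eqxx in E2.
have S1 : \sum_(i < n | i != c :> nat) phi i * X i = S.
  by apply: eq_bigr => i /negbTE ic; rewrite /phi ic mulrAC.
have S2 : \sum_(i < n | i != c :> nat) psi i * Y i = S.
  by apply: eq_bigr => i /negbTE ic; rewrite /psi ic.
rewrite S1 (@sum_ordD3 R n (fun j => 0 < j)%N
  (fun j => phi j * X (par j) + phi (par j) * X j) b c d) // in E1.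
rewrite S2 (@sum_ordD3 R n (fun j => 0 < j)%N
  (fun j => psi j * Y (par' j) + psi (par' j) * Y j) b c d) // in E2.
set C1 := \sum_(j < n | _) _ in E1.
set C2 := \sum_(j < n | _) _ in E2.
(* An edge other than those above [b], [c], [d] has the same parent in both trees, avoids [c], and
   carries one factor [m] at both ends. *)
have CE : C1 = C2.
  apply: eq_bigr => j /andP [j0 /and3P [jb jc jd]].
  have j0n : (0 < j < n)%N by rewrite j0 ltn_ord.
  have pjc : par j != c by apply: contra_neq jb; exact: ch.
  have [DbE DdE] := D j j0n jb jc jd.
  have mE : m j = m (par j) by rewrite /m DbE DdE.
  rewrite /phi /psi /par' /switch_par (negbTE jb) (negbTE jd) (negbTE jc) (negbTE pjc) -mE.
  by ring.
have phib : phi b = k * Y b by rewrite /phi (negbTE bc) m_b.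
have phid : phi d = s * Y d by rewrite /phi eq_sym (negbTE dc) m_d.
have phi0 : phi 0%N = Y 0%N by rewrite /phi cE m_root mul1r.
have phic : phi c = 0 by rewrite /phi eqxx.
have psib : psi b = k * X b by rewrite /psi (negbTE bc) m_b.
have psid : psi d = s * X d by rewrite /psi eq_sym (negbTE dc) m_d.
have psi0 : psi 0%N = X 0%N by rewrite /psi cE m_root mul1r.
have psic : psi c = s * X 0%N by rewrite /psi eqxx.
have pb' : par' b = 0%N by rewrite /par' /switch_par eqxx.
have pd' : par' d = c by rewrite /par' /switch_par db eqxx.
have pc' : par' c = 0%N by rewrite /par' /switch_par cb' (negbTE dc).
rewrite -CE pb' pc' pd' psib psic psid psi0 in E2.
rewrite pb pc pd phib phid phi0 phic in E1.
(* Eliminating [X b] by the equation at [c], and [a * X 0] by the one at the root, reduces this to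
   [X e < X e * (X 0)^2 / (X c * (X c + X e))], which is the assumed inequality. *)
have defect : k * X b + s * X 0%N < X c + X d.
  have kb : k * X b = a * X 0%N - k * X 0%N.
    have -> : X b = a * X c - X 0%N by rewrite eqc; ring.
    by rewrite mulrBr mulrCA kc.
  have kX : k * X 0%N = X 0%N ^+ 2 / X c by rewrite /k; field; rewrite gt_eqF.
  have sX : s * X 0%N = X 0%N ^+ 2 / (X c + X e).
    by rewrite /s; field; rewrite gt_eqF // addr_gt0.
  rewrite kb eq0 kX sX.
  have : X e < X 0%N ^+ 2 / X c - X 0%N ^+ 2 / (X c + X e).
    have -> : X 0%N ^+ 2 / X c - X 0%N ^+ 2 / (X c + X e) =
              X e * (X 0%N ^+ 2 / (X c * (X c + X e))).
      by field; rewrite !gt_eqF // addr_gt0.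
    by rewrite ltr_pMr // ltr_pdivlMr ?mul1r // mulr_gt0 // addr_gt0.
  by rewrite -[ltRHS]addrC; set u := _ / X c; set v := _ / (X c + X e); clear -u v; lra.
(* This is the equation of [psi] at [c] in the new tree, where the neighbours of [c] are the root
   and [d]. *)
have ac : X 0%N + s * X d = a * (s * X 0%N).
  by rewrite mulrCA eq0 -{1}se; ring.
pose W := s * X 0%N * Y c + S.
have W0 : 0 < W by apply: ltr_wpDr S0 _; do 2!apply: mulr_gt0 => //.
rewrite -/W in E2.
(* [W] is the pairing of [psi] with [Y]. All terms of the two edge sums cancel except the deficit at
   the root, weighted by [Y 0]. *)
have : a' * W - a * W = Y 0%N * (k * X b + s * X 0%N - (X c + X d)).
  rewrite E2 /W [a * (_ + _)]mulrDr E1.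
  have -> : a * (s * X 0%N * Y c) = (X 0%N + s * X d) * Y c by rewrite ac; ring.
  have -> : k * Y b * X c = X 0%N * Y b by rewrite -kc; ring.
  by ring.
move=> dW; rewrite -(ltr_pM2r W0) -subr_lt0 dW pmulr_rlt0 // subr_lt0.
exact: defect.
Qed.

(** * Isomorphisms and vertex numbering *)

Lemma isomorphic_eigenvalue (R : realType) n (G H : rel 'I_n) (a : R) :
  isomorphic G H -> eigenvalue (adjmx H : 'M[R]_n) a ->
  eigenvalue (adjmx G : 'M[R]_n) a.
Proof.
case=> s sE /eigenvalueP [v vH v0]; apply/eigenvalueP.
exists (\row_i v 0 (s i)).
  apply/rowP => j; have /rowP /(_ (s j)) := vH; rewrite !mxE => <-.
  rewrite [RHS](reindex_inj (@perm_inj _ s)) /=.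
  by apply: eq_bigr => i _; rewrite !mxE sE.
apply: contra_neq v0 => /rowP w0; apply/rowP => i.
by have := w0 ((s^-1)%g i); rewrite !mxE permKV.
Qed.

Lemma isomorphic_sym (T : finType) (G H : rel T) : isomorphic G H -> isomorphic H G.
Proof. by case=> s sE; exists (s^-1)%g => x y; rewrite -sE !permKV. Qed.

Lemma isomorphic_rho (R : realType) n (G H : rel 'I_n) :
  isomorphic G H -> rho R G = rho R H.
Proof.
move=> GH; rewrite /rho; congr sup; apply/seteqP; split=> a /=.
  by apply: isomorphic_eigenvalue; exact: isomorphic_sym.
exact: isomorphic_eigenvalue.
Qed.

(* After a switch detaching [m] from its branch, [m] becomes the first vertex on
   another path, just below label [M.+1], and the labels in between slide down. *)
Definition relabel (m M k : nat) : nat :=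
  if k == m then M else if (m < k <= M)%N then k.-1 else k.

Lemma relabel_isomorphic n (G H : rel nat) m M : (m <= M < n)%N ->
  (forall i j, (i < n)%N -> (j < n)%N -> H (relabel m M i) (relabel m M j) = G i j) ->
  isomorphic (fun i j : 'I_n => G i j) (fun i j : 'I_n => H i j).
Proof.
move=> mMn HG.
have lt_r (i : 'I_n) : (relabel m M i < n)%N.
  by rewrite /relabel; have := ltn_ord i; do 2?case: ifP; lia.
have inj_r : injective (fun i => Ordinal (lt_r i)).
  move=> i j [] /eqP; rewrite /relabel => ij; apply: val_inj => /=.
  by move: ij; do ?case: ifP; lia.
by exists (perm inj_r) => i j; rewrite !permE /= HG.
Qed.

(** As [0 < m], the relabelling fixes the root, so it is enough that it intertwines the parent
    functions. *)
Lemma tree_rel_isomorphic n (par par' : nat -> nat) m M : (0 < m <= M)%N -> (M < n)%N ->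
  rooted n par ->
  (forall j, (0 < j < n)%N -> par' (relabel m M j) = relabel m M (par j)) ->
  isomorphic (@tree_rel n par) (@tree_rel n par').
Proof.
move=> mM Mn rp E; apply: (@relabel_isomorphic n _ _ m M) => [|i j ilt jlt]; first by lia.
have r0 k : (0 < relabel m M k)%N = (0 < k)%N.
  by rewrite /relabel; do ?case: ifP; lia.
have rI k l : (relabel m M k == relabel m M l) = (k == l).
  by rewrite /relabel; do ?case: ifP; lia.
rewrite /tree_adj !r0; congr (_ || _).
  by case: ltnP => //= j0; rewrite E ?j0 // rI.
by case: ltnP => //= i0; rewrite E ?i0 // rI.
Qed.

Lemma switch_two_switch n par b c d Db Dd :
  switchable n par b c d Db Dd ->
  two_switch (@tree_rel n par) (@tree_rel n (switch_par par b c d)).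
Proof.
case=> rp bn dn c0 cb cd bd pb pc pd ch _ _ _ _.
have cn : (c < n)%N by lia.
have n0 : (0 < n)%N by lia.
(* In this order the deleted edges are [cb] and [d0], the added ones [cd] and [b0]. *)
exists (Ordinal cn), (Ordinal bn), (Ordinal dn), (Ordinal n0).
split; first by rewrite /= !inE -!val_eqE /=; lia.
rewrite /tree_rel /tree_adj /= pb pc pd.
split; first by lia.
split; first by lia.
split; first by lia.
split; first by lia.
move=> x y; rewrite /upair -!val_eqE /=.
have := ltn_ord x; have := ltn_ord y; move: (val x) (val y) => {}x {}y yn xn.
rewrite /switch_par.
clear -c0 cb cd bd pb pc pd.
have [->|yb] := eqVneq y b.
  rewrite pb; have [->|xb] := eqVneq x b; first by rewrite ?pb; lia.
  have [->|xd] := eqVneq x d; first by rewrite ?pd; lia.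
  by have [->|xc] := eqVneq x c; rewrite ?pc; lia.
have [->|yd] := eqVneq y d.
  rewrite pd; have [->|xb] := eqVneq x b; first by rewrite ?pb; lia.
  have [->|xd] := eqVneq x d; first by rewrite ?pd; lia.
  by have [->|xc] := eqVneq x c; rewrite ?pc; lia.
have [->|xb] := eqVneq x b.
  by rewrite pb; have [->|yc] := eqVneq y c; rewrite ?pc; lia.
have [->|xd] := eqVneq x d.
  by rewrite pd; have [->|yc] := eqVneq y c; rewrite ?pc; lia.
by lia.
Qed.

(* [a] and [B.+1] are the first vertices on the paths from [u = 0] to [v1] and to
   [v2]; the pendant paths at [v1] occupy the labels up to [B]. *)
Definition branch_par (a v1 B v2 y : nat) : nat :=
  if [|| y == 1, y == a | y == B.+1]%N then 0%N
  else if (v1 < y <= B)%N && odd (y - v1) then v1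
  else if (v2 < y)%N && odd (y - v2) then v2
  else y.-1.

Definition tpar (r1 : nat) (t : nat * nat * nat) : nat -> nat :=
  let: (h, q1, q2) := t in
  branch_par h.+1 (h + q1) (h + q1 + 2 * r1) (h + q1 + 2 * r1 + q2).

(** The [k]-th pendant path occupies [st + 2k] and [st + 2k + 1], so the parity of [y - st] tells a
    neighbour of [v] from an end vertex. *)
Lemma pendants_eE v st r x y :
  pendants_e v st r x y =
  (st <= y < st + 2 * r)%N && (x == if odd (y - st) then y.-1 else v).
Proof.
apply/hasP/idP => [[k]|/andP [yr /eqP ->]].
  by rewrite mem_iota /path_e; case: ifP; lia.
exists (y - st)./2; first by rewrite mem_iota; lia.
by rewrite /path_e; case: ifP; lia.
Qed.

Lemma path_eE s st len x y :
  path_e s st len x y =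
  (st <= y < st + len)%N && (x == if y == st then s else y.-1).
Proof. by rewrite /path_e; case: (y =P st) => ?; lia. Qed.

(** The five families of directed edges have heads [y] in disjoint intervals that cover the labels
    from [1] to [n - 1]; on each interval the tail is the parent of [y]. *)
Lemma tree_eE n r1 r2 h q1 q2 x y : inF n r1 r2 (h, q1, q2) -> (y < n)%N ->
  tree_e r1 r2 h q1 q2 x y = (0 < y)%N && (x == tpar r1 (h, q1, q2) y).
Proof.
rewrite /inF => /and4P [h2 q12 q22 /eqP nE] yn.
rewrite /tree_e !path_eE !pendants_eE.
set B := (h + q1 + 2 * r1)%N.
set I1 := (1 <= y < _)%N; set I2 := (h + 1 <= y < _)%N; set I3 := (h + q1 + 1 <= y < _)%N.
set I4 := (B + 1 <= y < _)%N; set I5 := (B + q2 + 1 <= y < _)%N.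
have t1 : I1 -> tpar r1 (h, q1, q2) y = if y == 1%N then 0%N else y.-1.
  by rewrite /tpar /branch_par /I1 -/B; clear I1 I2 I3 I4 I5; do ?case: ifP; lia.
have t2 : I2 -> tpar r1 (h, q1, q2) y = if y == (h + 1)%N then 0%N else y.-1.
  by rewrite /tpar /branch_par /I2 -/B; clear -q12; do ?case: ifP; lia.
have t3 : I3 -> tpar r1 (h, q1, q2) y =
    if odd (y - (h + q1 + 1)) then y.-1 else (h + q1)%N.
  by rewrite /tpar /branch_par /I3 -/B; clear -q12; do ?case: ifP; lia.
have t4 : I4 -> tpar r1 (h, q1, q2) y = if y == (B + 1)%N then 0%N else y.-1.
  by rewrite /tpar /branch_par /I4 -/B; clear -q12 q22; do ?case: ifP; lia.
have t5 : I5 -> tpar r1 (h, q1, q2) y =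
    if odd (y - (B + q2 + 1)) then y.-1 else (B + q2)%N.
  by rewrite /tpar /branch_par /I5 -/B; clear -q12 q22; do ?case: ifP; lia.
have [y0|y0] := posnP y.
  by have [-> -> -> -> ->] : [/\ I1 = false, I2 = false, I3 = false, I4 = false & I5 = false];
    first by rewrite /I1 /I2 /I3 /I4 /I5 y0; clear; split; lia.
have [i1|i1] := boolP I1.
  have [-> -> -> ->] : [/\ I2 = false, I3 = false, I4 = false & I5 = false].
    by move: i1; rewrite /I1 /I2 /I3 /I4 /I5; clear; split; lia.
  by rewrite t1 //= orbF.
have [i2|i2] := boolP I2.
  have [-> -> ->] : [/\ I3 = false, I4 = false & I5 = false].
    by move: i2; rewrite /I2 /I3 /I4 /I5; clear; split; lia.
  by rewrite t2 //= orbF.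
have [i3|i3] := boolP I3.
  have [-> ->] : I4 = false /\ I5 = false.
    by move: i3; rewrite /I3 /I4 /I5; clear; split; lia.
  by rewrite t3 //= orbF.
have [i4|i4] := boolP I4.
  have -> : I5 = false by move: i4; rewrite /I4 /I5; clear; lia.
  by rewrite t4 //= orbF.
have i5 : I5.
  by move: i1 i2 i3 i4; rewrite /I1 /I2 /I3 /I4 /I5; clear -y0 yn nE; lia.
by rewrite i5 t5.
Qed.

Lemma tree_graphE n r1 r2 t : inF n r1 r2 t ->
  tree_graph n r1 r2 t = @tree_rel n (tpar r1 t).
Proof.
case: t => [[h q1] q2] tF; apply/funext => i; apply/funext => j.
by rewrite /tree_graph /tree_rel /tree_adj !(tree_eE _ tF).
Qed.

Lemma tpar_rooted n r1 t : rooted n (tpar r1 t).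
Proof.
by case: t => [[h q1] q2] j jn; rewrite /tpar /branch_par; do ?case: ifP; lia.
Qed.

(** * The moves as switches of the parent function *)

Ltac case_ifs :=
  repeat match goal with |- context [if ?b then _ else _] =>
    lazymatch b with context [if _ then _ else _] => fail | _ =>
      case: (boolP b) => ? end end.
Ltac tpar_lia := rewrite /tpar /branch_par /=; case_ifs; intros; try split; lia.

(** Common pattern of the three moves, with [c = m], [b = m.+1] and [d = M.+1]: the vertex [m]
    receives the label [M] just before [d], and the block from [m.+1] to [M] slides down by one.
    Parents of block vertices from [m.+2] on are in the block or the root; labels outside keep their
    parents, which are outside too. *)
Lemma relabel_switch n (par par' : nat -> nat) m M :
  (0 < m)%N -> (m < M)%N -> par m = 0%N ->
  par' m = 0%N -> par' M = 0%N -> par' M.+1 = M ->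
  (forall j, (m.+1 < j <= M)%N ->
     [/\ par' j.-1 = (par j).-1, (par j <= M)%N & (par j == 0%N) || (m < par j)%N]) ->
  (forall j, (0 < j < n)%N -> (j < m)%N || (M.+1 < j)%N ->
     par' j = par j /\ ((par j < m)%N || (M < par j)%N)) ->
  forall j, (0 < j < n)%N ->
  par' (relabel m M j) = relabel m M (switch_par par m.+1 m M.+1 j).
Proof.
move=> m0 mM pm p'm p'M p'M1 mid out j j0n.
have rout k : (k < m)%N || (M < k)%N -> relabel m M k = k.
  by rewrite /relabel; case_ifs; lia.
have rmid k : (m < k <= M)%N -> relabel m M k = k.-1.
  by rewrite /relabel; case_ifs; lia.
have rm : relabel m M m = M by rewrite /relabel eqxx.
have r0 : relabel m M 0 = 0%N by rewrite rout // m0.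
have [-> | jb] := eqVneq j m.+1; first by rewrite /switch_par eqxx r0 rmid //; lia.
have [-> | jd] := eqVneq j M.+1.
  have -> : switch_par par m.+1 m M.+1 M.+1 = m.
    by rewrite /switch_par eqxx; case: eqP => //; lia.
  by rewrite rm rout ?p'M1 // ltnSn orbT.
have -> : switch_par par m.+1 m M.+1 j = par j.
  by rewrite /switch_par (negbTE jb) (negbTE jd).
have [-> | jm] := eqVneq j m; first by rewrite rm p'M pm r0.
have [jM | jM] := boolP (m.+1 < j <= M)%N.
  have [p1 p2 p3] := mid j jM; rewrite rmid ?p1; last by lia.
  by case/orP: p3 => [/eqP -> | p3]; [rewrite r0 | rewrite rmid ?p3].
have jo : (j < m)%N || (M.+1 < j)%N by clear -jb jd jm jM; lia.
have [p1 p2] := out j j0n jo.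
by rewrite rout ?p1 ?rout //; clear -jo; lia.
Qed.

Section BranchPar.
Variables (n a v1 B v2 : nat).
Hypotheses (a2 : (2 < a)%N) (av1 : (a < v1)%N) (v1B : (v1 <= B)%N) (Bv2 : (B.+1 < v2)%N).

Lemma branch_parE a' v1' B' v2' y c1 c2 c3 :
  [|| y == 1, y == a' | y == B'.+1]%N = c1 ->
  (v1' < y <= B')%N && odd (y - v1') = c2 -> (v2' < y)%N && odd (y - v2') = c3 ->
  branch_par a' v1' B' v2' y =
  if c1 then 0%N else if c2 then v1' else if c3 then v2' else y.-1.
Proof. by rewrite /branch_par => -> -> ->. Qed.

Let in_v1 j := (v1 < j <= B)%N && odd (j - v1).
Let in_v2 j := (v2 < j)%N && odd (j - v2).

(** Only the pendant path at the root slides, so [a] alone drops. *)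
Lemma branch_par_alpha : (3 < a)%N -> forall j, (0 < j < n)%N ->
  branch_par a.-1 v1 B v2 (relabel 1 a.-1 j) =
  relabel 1 a.-1 (switch_par (branch_par a v1 B v2) 2 1 a.-1.+1 j).
Proof.
move=> a3; apply: relabel_switch; try lia.
- by [].
- by [].
- by rewrite (@branch_parE _ _ _ _ _ true _ _ _ erefl erefl) //; lia.
- by rewrite (@branch_parE _ _ _ _ _ false false false) //=; lia.
- move=> j jI.
  rewrite (@branch_parE _ _ _ _ j.-1 false false false); try lia.
  by rewrite (@branch_parE _ _ _ _ j false false false); try split; lia.
- move=> j j0n jI.
  rewrite (@branch_parE _ _ _ _ j (j == B.+1) (in_v1 j) (in_v2 j)) //; try lia.
  rewrite (@branch_parE _ _ _ _ j (j == B.+1) (in_v1 j) (in_v2 j)) //; try lia.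
  by split=> //; case: eqP => // _; rewrite /in_v1 /in_v2; case_ifs; lia.
Qed.

(** The pendant path and the whole branch of [v1] slide, so [a], [v1] and [B] drop. *)
Lemma branch_par_gamma : (3 < a)%N -> forall j, (0 < j < n)%N ->
  branch_par a.-1 v1.-1 B.-1 v2 (relabel 1 B j) =
  relabel 1 B (switch_par (branch_par a v1 B v2) 2 1 B.+1 j).
Proof.
move=> a3; apply: relabel_switch; try lia.
- by [].
- by [].
- by rewrite (@branch_parE _ _ _ _ _ true _ _ _ erefl erefl) //; lia.
- by rewrite (@branch_parE _ _ _ _ _ false false false) //=; lia.
- move=> j jI.
  rewrite (@branch_parE _ _ _ _ j.-1 (j == a) (in_v1 j) false); try (rewrite ?/in_v1; lia).
  rewrite (@branch_parE _ _ _ _ j (j == a) (in_v1 j) false) //; try lia.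
  by case: eqP => // _; rewrite /in_v1; case_ifs; split; lia.
- move=> j j0n jI.
  rewrite (@branch_parE _ _ _ _ j false false (in_v2 j)) //; try lia.
  rewrite (@branch_parE _ _ _ _ j false false (in_v2 j)) //; try lia.
  by split=> //; rewrite /in_v2; case_ifs; lia.
Qed.

(** Only the branch of [v1] slides; it starts at [a] as before, while [v1] and [B] drop. *)
Lemma branch_par_beta : (a.+1 < v1)%N -> forall j, (0 < j < n)%N ->
  branch_par a v1.-1 B.-1 v2 (relabel a B j) =
  relabel a B (switch_par (branch_par a v1 B v2) a.+1 a B.+1 j).
Proof.
move=> a3; apply: relabel_switch; try lia.
- by rewrite (@branch_parE _ _ _ _ _ true _ _ _ erefl erefl) //; lia.
- by rewrite (@branch_parE _ _ _ _ _ true _ _ _ erefl erefl) //; lia.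
- by rewrite (@branch_parE _ _ _ _ _ true _ _ _ erefl erefl) //; lia.
- by rewrite (@branch_parE _ _ _ _ _ false false false) //=; lia.
- move=> j jI.
  rewrite (@branch_parE _ _ _ _ j.-1 false (in_v1 j) false); try (rewrite ?/in_v1; lia).
  rewrite (@branch_parE _ _ _ _ j false (in_v1 j) false) //; try lia.
  by rewrite /in_v1; case_ifs; split; lia.
- move=> j j0n jI.
  rewrite (@branch_parE _ _ _ _ j (j == 1%N) false (in_v2 j)) //; try lia.
  rewrite (@branch_parE _ _ _ _ j (j == 1%N) false (in_v2 j)) //; try lia.
  by split=> //; rewrite /in_v2; case_ifs; lia.
Qed.

End BranchPar.

Section Moves.
Variables (n r1 r2 h q1 q2 : nat).
Hypothesis tF : inF n r1 r2 (h, q1, q2).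
Let B : nat := (h + q1 + 2 * r1)%N.

Lemma inF_bounds : [/\ (2 <= h)%N, (2 <= q1)%N, (2 <= q2)%N &
  n = (1 + h + q1 + q2 + 2 * (r1 + r2))%N].
Proof. by case/and4P: tF => ? ? ? /eqP. Qed.

(** Vertex [1], first on the pendant path, is inserted between the root and the path to [v1]. The
    two rescaled branches are the rest of the pendant path and the branch of [v1]. *)
Lemma switchable_alpha :
  switchable n (tpar r1 (h, q1, q2)) 2 1 h.+1
    (fun y => 2 <= y <= h)%N (fun y => h.+1 <= y <= B)%N.
Proof.
have [h2 q12 q22 nE] := inF_bounds.
split; rewrite /B; [exact: tpar_rooted | .. ]; clear B tF; try lia; try by tpar_lia.
- by move=> j j0n; tpar_lia.
- by move=> j j0n; tpar_lia.
Qed.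

Lemma switchable_gamma :
  switchable n (tpar r1 (h, q1, q2)) 2 1 B.+1
    (fun y => 2 <= y <= h)%N (fun y => B.+1 <= y)%N.
Proof.
have [h2 q12 q22 nE] := inF_bounds.
split; rewrite /B; [exact: tpar_rooted | .. ]; clear B tF; try lia; try by tpar_lia.
- by move=> j j0n; tpar_lia.
- by move=> j j0n; tpar_lia.
Qed.

(** Vertex [h.+1], first on the path to [v1], is inserted between the root and the path to [v2]. *)
Lemma switchable_beta :
  switchable n (tpar r1 (h, q1, q2)) h.+2 h.+1 B.+1
    (fun y => h.+2 <= y <= B)%N (fun y => B.+1 <= y)%N.
Proof.
have [h2 q12 q22 nE] := inF_bounds.
split; rewrite /B; [exact: tpar_rooted | .. ]; clear B tF; try lia; try by tpar_lia.
- by move=> j j0n; tpar_lia.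
- by move=> j j0n; tpar_lia.
Qed.

Lemma iso_alpha : (3 <= h)%N ->
  isomorphic (@tree_rel n (switch_par (tpar r1 (h, q1, q2)) 2 1 h.+1))
             (tree_graph n r1 r2 (alpha (h, q1, q2))).
Proof.
have [h2 q12 q22 nE] := inF_bounds => h3; rewrite tree_graphE; last first.
  by rewrite /inF /=; lia.
apply: (@tree_rel_isomorphic _ _ _ 1 h); try lia.
  exact: switch_rooted switchable_alpha.
rewrite /tpar /alpha; have -> : (h.-1 + q1.+1 = h + q1)%N by lia.
have -> : h.-1.+1 = h by lia.
by apply: (@branch_par_alpha n h.+1); lia.
Qed.

Lemma iso_gamma : (3 <= h)%N ->
  isomorphic (@tree_rel n (switch_par (tpar r1 (h, q1, q2)) 2 1 B.+1))
             (tree_graph n r1 r2 (gamma (h, q1, q2))).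
Proof.
have [h2 q12 q22 nE] := inF_bounds => h3; rewrite tree_graphE; last first.
  by rewrite /inF /=; lia.
apply: (@tree_rel_isomorphic _ _ _ 1 B); try (rewrite /B; lia).
  exact: switch_rooted switchable_gamma.
rewrite /tpar /gamma -/B; have -> : (h.-1 + q1 = (h + q1).-1)%N by lia.
have -> : ((h + q1).-1 + 2 * r1 = B.-1)%N by rewrite /B; lia.
have -> : (B.-1 + q2.+1 = B + q2)%N by rewrite /B; lia.
have -> : h.-1.+1 = h by lia.
apply: (@branch_par_gamma n h.+1); rewrite /B; lia.
Qed.

Lemma iso_beta : (3 <= q1)%N ->
  isomorphic (@tree_rel n (switch_par (tpar r1 (h, q1, q2)) h.+2 h.+1 B.+1))
             (tree_graph n r1 r2 (beta (h, q1, q2))).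
Proof.
have [h2 q12 q22 nE] := inF_bounds => q13; rewrite tree_graphE; last first.
  by rewrite /inF /=; lia.
apply: (@tree_rel_isomorphic _ _ _ h.+1 B); try (rewrite /B; lia).
  exact: switch_rooted switchable_beta.
rewrite /tpar /beta -/B; have -> : (h + q1.-1 = (h + q1).-1)%N by lia.
have -> : ((h + q1).-1 + 2 * r1 = B.-1)%N by rewrite /B; lia.
have -> : (B.-1 + q2.+1 = B + q2)%N by rewrite /B; lia.
apply: (@branch_par_beta n h.+1); rewrite /B; lia.
Qed.

End Moves.

Lemma switch_obtained n r1 r2 t t' b c d Db Dd : inF n r1 r2 t ->
  switchable n (tpar r1 t) b c d Db Dd ->
  isomorphic (@tree_rel n (switch_par (tpar r1 t) b c d)) (tree_graph n r1 r2 t') ->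
  obtained_by_2switch (tree_graph n r1 r2 t) (tree_graph n r1 r2 t').
Proof.
move=> tF sw iso; exists (@tree_rel n (switch_par (tpar r1 t) b c d)); split => //.
by rewrite (tree_graphE tF); exact: switch_two_switch sw.
Qed.

(** * Reaching every tree of the family by iterated moves *)

Lemma clos_iter (A : Type) (step : relation A) (f : nat -> A) k :
  (forall i, (i < k)%N -> step (f i) (f i.+1)) -> clos_refl_trans A step (f 0%N) (f k).
Proof.
elim: k => [|k IH] st; first exact: rt_refl.
apply: rt_trans (IH _) _; first by move=> i ik; apply: st; lia.
by apply: rt_step; apply: st.
Qed.

Lemma reach_alpha (step : relation (nat * nat * nat)) h q1 q2 k :
  (forall t, dom_alpha t -> step t (alpha t)) -> (2 <= h)%N ->
  clos_refl_trans _ step (h + k, q1, q2)%N (h, q1 + k, q2)%N.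
Proof.
move=> st h2.
have := @clos_iter _ step (fun i => (h + k - i, q1 + i, q2)%N) k.
rewrite subn0 addn0 addnK; apply => i ik.
have -> : (h + k - i.+1, q1 + i.+1, q2)%N = alpha (h + k - i, q1 + i, q2)%N.
  by rewrite /alpha; congr (_, _, _); lia.
by apply: st; rewrite /dom_alpha /=; lia.
Qed.

Lemma reach_beta (step : relation (nat * nat * nat)) h q1 q2 k :
  (forall t, dom_beta t -> step t (beta t)) -> (2 <= q1)%N ->
  clos_refl_trans _ step (h, q1 + k, q2)%N (h, q1, q2 + k)%N.
Proof.
move=> st h2.
have := @clos_iter _ step (fun i => (h, q1 + k - i, q2 + i)%N) k.
rewrite subn0 addn0 addnK; apply => i ik.
have -> : (h, q1 + k - i.+1, q2 + i.+1)%N = beta (h, q1 + k - i, q2 + i)%N.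
  by rewrite /beta; congr (_, _, _); lia.
by apply: st; rewrite /dom_beta /=; lia.
Qed.

Lemma reach_gamma (step : relation (nat * nat * nat)) h q1 q2 k :
  (forall t, dom_gamma t -> step t (gamma t)) -> (2 <= h)%N ->
  clos_refl_trans _ step (h + k, q1, q2)%N (h, q1, q2 + k)%N.
Proof.
move=> st h2.
have := @clos_iter _ step (fun i => (h + k - i, q1, q2 + i)%N) k.
rewrite subn0 addn0 addnK; apply => i ik.
have -> : (h + k - i.+1, q1, q2 + i.+1)%N = gamma (h + k - i, q1, q2 + i)%N.
  by rewrite /gamma; congr (_, _, _); lia.
by apply: st; rewrite /dom_gamma /=; lia.
Qed.

(** [alpha] first brings [h] to its final value, storing the surplus of [q2] in [q1]; [beta] then
    passes that surplus on. *)
Lemma reach_ab n r1 r2 t : inF n r1 r2 t ->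
  clos_refl_trans _ step_ab (n - 5 - 2 * (r1 + r2), 2, 2)%N t.
Proof.
case: t => [[h q1] q2] tF; have [h2 q12 q22 nE] := inF_bounds tF.
apply: (rt_trans _ _ _ (h, q1 + (q2 - 2), 2)%N).
  have -> : (n - 5 - 2 * (r1 + r2) = h + (q1 + q2 - 4))%N by lia.
  have -> : (q1 + (q2 - 2) = 2 + (q1 + q2 - 4))%N by lia.
  by apply: reach_alpha => // t d; left.
have {2}-> : (q2 = 2 + (q2 - 2))%N by lia.
by apply: reach_beta => // t d; right.
Qed.

(** [alpha] brings [q1] to its final value, then [gamma] does so for [q2]. *)
Lemma reach_ag n r1 r2 t : inF n r1 r2 t ->
  clos_refl_trans _ step_ag (n - 5 - 2 * (r1 + r2), 2, 2)%N t.
Proof.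
case: t => [[h q1] q2] tF; have [h2 q12 q22 nE] := inF_bounds tF.
apply: (rt_trans _ _ _ (h + (q2 - 2), q1, 2)%N).
  have -> : (n - 5 - 2 * (r1 + r2) = h + (q2 - 2) + (q1 - 2))%N by lia.
  have {2}-> : (q1 = 2 + (q1 - 2))%N by lia.
  by apply: reach_alpha => [t d|]; [left | lia].
have {2}-> : (q2 = 2 + (q2 - 2))%N by lia.
by apply: reach_gamma => // t d; right.
Qed.

(** * Ratios of the entries of the Perron vector *)

Section Eigen.
Variables (R : realType) (n : nat) (par : nat -> nat) (a : R) (X : nat -> R).
Hypothesis eX : tree_eigen n par a X.

Lemma tree_eigen_leaf i : (0 < i < n)%N ->
  (forall j, (0 < j < n)%N -> par j <> i) -> a * X i = X (par i).
Proof.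
case/andP=> i0 ilt nc; rewrite eX // i0 big1 ?addr0 // => j /andP [j0 /eqP pj].
by case: (nc j); rewrite // j0 ltn_ord.
Qed.

Lemma tree_eigen_child i k : (0 < i < n)%N -> (0 < k < n)%N -> par k = i ->
  (forall j, (0 < j < n)%N -> par j = i -> j = k) -> a * X i = X (par i) + X k.
Proof.
case/andP=> i0 ilt /andP [k0 kn] pk uk; rewrite eX // i0; congr (_ + _).
rewrite (big_pred1 (Ordinal kn)) // => j /=.
rewrite -val_eqE /=; apply/andP/eqP => [[j0 /eqP pj]|->].
  by apply: uk; rewrite ?j0 ?ltn_ord.
by rewrite k0 pk eqxx.
Qed.

Lemma tree_eigen_root c d e : [/\ (0 < c < n)%N, (0 < d < n)%N & (0 < e < n)%N] ->
  [/\ par c = 0%N, par d = 0%N & par e = 0%N] -> [/\ c != d, c != e & d != e] ->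
  (forall j, (0 < j < n)%N -> par j = 0%N -> [\/ j = c, j = d | j = e]) ->
  a * X 0%N = X c + X d + X e.
Proof.
case=> /andP [c0 cn] /andP [d0 dn] /andP [e0 en] [pc pd pe] [cd ce de] ch.
rewrite eX; last by lia.
rewrite add0r (@sum_ordD3 R n (fun j => (0 < j)%N && (par j == 0%N)) X c d e) //.
- rewrite big1 ?addr0 ?addrA // => j /andP [/andP [j0 /eqP pj] /and3P [jc jd je]].
  by have [] := ch j _ pj; rewrite ?j0 ?ltn_ord //; lia.
- by rewrite c0 pc.
- by rewrite d0 pd.
- by rewrite e0 pe.
Qed.

Lemma tree_eigen_par_ge j : (forall i, (i < n)%N -> 0 < X i) -> rooted n par ->
  (0 < j < n)%N -> X j <= a * X (par j).
Proof.
move=> X0 rp /andP [j0 jn]; have pn := rooted_lt rp jn j0; rewrite eX //.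
rewrite (bigD1 (Ordinal jn)) /=; last by rewrite j0 eqxx.
have s0 : 0 <= \sum_(i < n | (0 < i)%N && (par i == par j) && (i != Ordinal jn)) X i.
  by apply: sumr_ge0 => i _; rewrite ltW // X0.
have u0 : 0 <= (if (0 < par j)%N then X (par (par j)) else 0).
  by case: ltnP => // pj0; rewrite ltW // X0 // rooted_lt.
by rewrite addrCA lerDl addr_ge0.
Qed.

Lemma sum_progression (F : nat -> R) v r (P : pred nat) : (v + 2 * r < n)%N ->
  (forall j, (j < n)%N -> P j = (v < j <= v + 2 * r)%N && odd (j - v)) ->
  \sum_(j < n | P j) F j = \sum_(k < r) F (v + 2 * k).+1.
Proof.
(* The inverse reindexing uses [inord], which needs a nonempty index type. *)
move=> vn PE; case: r => [|r] in vn PE *.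
  by rewrite big_ord0 big1 // => j Pj; move: (PE j (ltn_ord j)); rewrite Pj; lia.
have lt_n (k : 'I_r.+1) : ((v + 2 * k).+1 < n)%N by have := ltn_ord k; lia.
rewrite (reindex_onto (fun k => Ordinal (lt_n k)) (fun j => inord (j - v).-1./2)) /=.
  apply: eq_bigl => k; rewrite PE ?lt_n // -val_eqE /= inordK; have := ltn_ord k; lia.
move=> j Pj; apply: val_inj => /=; move: Pj; rewrite PE ?ltn_ord // => Pj.
by rewrite inordK; lia.
Qed.

(** On a pendant path with two edges, the equations [a y = x + y'] and [a y' = y] give
    [(a^2 - 1) y = a x]. Summing over the [r] paths at [v] eliminates their entries. *)
Lemma tree_eigen_broom v r : (0 < v < n)%N -> (v + 2 * r < n)%N ->
  (forall j, (0 < j < n)%N -> (par j == v) = (v < j <= v + 2 * r)%N && odd (j - v)) ->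
  (forall j, (v < j <= v + 2 * r)%N -> ~~ odd (j - v) -> par j = j.-1) ->
  (forall j i, (0 < j < n)%N -> par j = i -> (v < i <= v + 2 * r)%N ->
     odd (i - v) /\ j = i.+1) ->
  (a ^+ 2 - 1) * (a * X v - X (par v)) = r%:R * a * X v.
Proof.
move=> /andP [v0 vn] vrn pv pe ch.
have -> : a * X v - X (par v) = \sum_(k < r) X (v + 2 * k).+1.
  rewrite eX // v0 addrC addKr.
  rewrite -(@sum_progression X v r (fun j => (0 < j)%N && (par j == v))) // => j jn.
  by case: j jn => // j jn; rewrite pv.
rewrite mulr_sumr (eq_bigr (fun=> a * X v)); last first.
  move=> [k kr] _ /=; set i := (v + 2 * k).+1.
  have pi : par i = v by apply/eqP; rewrite pv /i; lia.
  have pi1 : par i.+1 = i by rewrite pe /i //; lia.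
  have e1 : a * X i = X v + X i.+1.
    rewrite -pi; apply: tree_eigen_child; rewrite ?pi1 //; try (rewrite /i; lia).
    by move=> j jn pj; have [] := ch j i jn pj; rewrite /i; lia.
  have e2 : a * X i.+1 = X i.
    rewrite -{2}pi1; apply: tree_eigen_leaf; first by rewrite /i; lia.
    by move=> j jn pj; have [] := ch j i.+1 jn pj; rewrite /i; lia.
  have -> : X v = a * X i - X i.+1 by rewrite e1; ring.
  by rewrite mulrBr e2; ring.
by rewrite sumr_const card_ord -[LHS]mulr_natl mulrA.
Qed.

(** Along a path, the ratio of an entry to its parent entry is [1 / (a - t)] with [t] the next
    ratio. This map is increasing, so an upper bound [k] with [1 / (a - k) <= k] travels towards the
    root. *)
Lemma path_ratio_lt (k : R) lo hi : 0 < k -> 1 <= k * (a - k) ->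
  (forall i, (lo <= i < hi)%N -> par i.+1 = i) ->
  (forall i, (lo <= i < hi)%N -> a * X i = X (par i) + X i.+1) ->
  (forall i, (lo <= i <= hi)%N -> 0 < X i) -> (lo <= hi)%N ->
  X hi < k * X (par hi) -> X lo < k * X (par lo).
Proof.
move=> k0 k1 pS eqn X0 /subnKC; move: (hi - lo)%N => m E.
elim: m hi pS eqn X0 E => [|m IH] hi pS eqn X0 E.
  by have <- : lo = hi by lia.
have {E}E : hi = (lo + m).+1 by lia.
subst hi; rewrite pS; last by lia.
move=> h; apply: (IH (lo + m)%N) => //; try by move=> i il; do ?[apply: pS|apply: eqn|apply: X0]; lia.
have e := eqn (lo + m)%N ltac:(lia); have x0 := X0 (lo + m)%N ltac:(lia).
move: (X (lo + m)%N) (X (lo + m).+1) (X (par (lo + m)%N)) e x0 h => x y z e x0 h.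
nra.
Qed.

Lemma path_ratio_ge (k : R) lo hi : 0 < k -> k * (a - k) <= 1 ->
  (forall i, (lo <= i < hi)%N -> par i.+1 = i) ->
  (forall i, (lo <= i < hi)%N -> a * X i = X (par i) + X i.+1) ->
  (forall i, (lo <= i <= hi)%N -> 0 < X i) -> (lo <= hi)%N ->
  k * X (par hi) <= X hi -> k * X (par lo) <= X lo.
Proof.
move=> k0 k1 pS eqn X0 /subnKC; move: (hi - lo)%N => m E.
elim: m hi pS eqn X0 E => [|m IH] hi pS eqn X0 E.
  by have <- : lo = hi by lia.
have {E}E : hi = (lo + m).+1 by lia.
subst hi; rewrite pS; last by lia.
move=> h; apply: (IH (lo + m)%N) => //; try by move=> i il; do ?[apply: pS|apply: eqn|apply: X0]; lia.
have e := eqn (lo + m)%N ltac:(lia); have x0 := X0 (lo + m)%N ltac:(lia).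
move: (X (lo + m)%N) (X (lo + m).+1) (X (par (lo + m)%N)) e x0 h => x y z e x0 h.
nra.
Qed.

End Eigen.

(** * Estimates at the ends of the paths *)

(** The smaller root of [s^2 - a s + 1], a fixed point of the recursion of ratios
    [t -> 1 / (a - t)]. *)
Lemma small_root (R : rcfType) (a : R) : 2 < a ->
  exists s, [/\ 0 < s, s < 1 & s * (a - s) = 1].
Proof.
move=> a2; set r := Num.sqrt (a ^+ 2 - 4).
have r2 : r ^+ 2 = a ^+ 2 - 4 by rewrite sqr_sqrtr //; nra.
have r0 : 0 <= r by rewrite sqrtr_ge0.
have ra : r < a by rewrite ltNge; apply/negP => ar; nra.
have ar : a - 2 < r by rewrite ltNge; apply/negP => ar; nra.
exists ((a - r) / 2); split; [lra | lra |].
have -> : a - (a - r) / 2 = (a + r) / 2 by field.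
have -> : (a - r) / 2 * ((a + r) / 2) = (a ^+ 2 - r ^+ 2) / 4 by field.
by rewrite r2; field.
Qed.

(** Since [r >= 2], the equation yields [(a^2 - 1) p <= (a^3 - 3 a) x]. It remains that
    [s (a^3 - 3 a) <= a^2 - 1]; by [a s = 1 + s^2] the left side is [a^2 + s^4 - s^2 - 2]. *)
Lemma broom_ratio_ge (R : realType) (a s r x p : R) :
  1 < a -> 0 < s -> s < 1 -> s * (a - s) = 1 -> 2 <= r -> 0 < x ->
  (a ^+ 2 - 1) * (a * x - p) = r * a * x -> s * p <= x.
Proof.
move=> a1 s0 s1 sa r2 x0 e.
have d0 : 0 < a ^+ 2 - 1 by nra.
rewrite -(ler_pM2l d0).
have h : (a ^+ 2 - 1) * p <= (a ^+ 3 - 3 * a) * x.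
  have -> : (a ^+ 2 - 1) * p = (a ^+ 2 - 1) * a * x - r * a * x by rewrite -e; ring.
  have : 0 <= (r - 2) * (a * x) by rewrite mulr_ge0 ?subr_ge0 // mulr_ge0 ?ltW //; lra.
  move=> hh; rewrite -subr_ge0; apply: le_trans hh _; rewrite -subr_ge0.
  by rewrite le_eqVlt; apply/orP; left; apply/eqP; ring.
rewrite mulrCA; apply: (@le_trans _ _ (s * ((a ^+ 3 - 3 * a) * x))); first by rewrite ler_pM2l.
rewrite mulrA ler_pM2r //.
have as_ : a * s = 1 + s ^+ 2 by rewrite -sa; ring.
have -> : s * (a ^+ 3 - 3 * a) =
    a ^+ 2 + (a * s) ^+ 2 - 3 * (a * s) + a ^+ 2 * (a * s - 1 - s ^+ 2) by ring.
rewrite as_; have u0 : 0 <= s ^+ 2 by apply: sqr_ge0.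
have u1 : s ^+ 2 <= 1 by nra.
have uu : s ^+ 2 * s ^+ 2 <= s ^+ 2 by rewrite ler_piMr.
clear -uu u0 u1; move: (s ^+ 2) uu u0 u1 => u uu u0 u1; nra.
Qed.

(** The rate [7/10] suits both uses: [7/10 + 10/7] is below the square root of [5], hence below [a],
    and [2 * (7/10)^2 < 1] gives [ratio_product_lt]. The number [223/100] is a lower approximation
    of that root. *)
Lemma decay_rate (R : realFieldType) (a : R) :
  2 < a -> 5 <= a ^+ 2 -> 1 <= 7 / 10 * (a - 7 / 10).
Proof. by move=> a2 a5; have a3 : 223 / 100 < a; [nra | lra]. Qed.

(** Here [x], [y], [z], [w] are successive entries from the centre of a broom towards the root. The
    bound on [r] gives [2 a x <= (a^2 - 1) y], then [(a^2 + 1) y <= 2 a z], and finally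
    [w >= z a (a^2 - 1) / (a^2 + 1)], where the factor of [z] exceeds [10/7]. *)
Lemma broom_ratio_lt (R : realFieldType) (a r x y z w : R) :
  2 < a -> 5 <= a ^+ 2 -> r + 2 <= a ^+ 2 - 1 -> 0 < x -> 0 < y -> 0 < z ->
  (a ^+ 2 - 1) * (a * x - y) = r * a * x -> a * y = z + x -> a * z = w + y ->
  z < 7 / 10 * w.
Proof.
move=> a2 a5 ra x0 y0 z0 e1 e2 e3.
have a0 : 0 < a by lra.
have c1 : 2 * a * x <= (a ^+ 2 - 1) * y.
  have -> : (a ^+ 2 - 1) * y = (a ^+ 2 - 1 - r) * (a * x).
    have -> : (a ^+ 2 - 1) * y = (a ^+ 2 - 1) * a * x - r * a * x by rewrite -e1; ring.
    by ring.
  by rewrite -mulrA ler_pM2r ?mulr_gt0 //; lra.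
have c2 : (a ^+ 2 + 1) * y <= 2 * a * z.
  have -> : z = a * y - x by rewrite e2; ring.
  have -> : 2 * a * (a * y - x) = 2 * a ^+ 2 * y - 2 * a * x by ring.
  by clear -c1; lra.
have -> : w = a * z - y by rewrite e3; ring.
have d0 : 0 < a ^+ 2 + 1 by clear -a5; lra.
rewrite -(ltr_pM2l d0).
have c3 : a ^+ 2 + 1 < 7 / 10 * a * (a ^+ 2 - 1).
  have a3 : 223 / 100 < a by clear -a2 a5; nra.
  have : 0 <= (a - 223 / 100) * (a ^+ 2 - 1).
    by rewrite mulr_ge0 //; clear -a3 a5; lra.
  by clear -a5; lra.
have : (a ^+ 2 + 1) * z < 7 / 10 * a * (a ^+ 2 - 1) * z by rewrite ltr_pM2r.
by clear -c2; lra.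
Qed.

Lemma ratio_product_lt (R : realFieldType) (x y z : R) :
  0 < x -> 0 < y -> x < 7 / 10 * z -> y < 7 / 10 * z -> x * (x + y) < z ^+ 2.
Proof. by move=> x0 y0 xz yz; nra. Qed.

Section Ratios.
Variables (R : realType) (n r1 r2 h q1 q2 : nat) (a : R) (X : nat -> R).
Hypothesis r12 : (2 <= r1)%N.
Hypothesis r1r2 : (r1 < r2)%N.
Hypothesis tF : inF n r1 r2 (h, q1, q2).
Let B : nat := (h + q1 + 2 * r1)%N.
Let par := tpar r1 (h, q1, q2).
Hypothesis eX : tree_eigen n par a X.
Hypothesis X0 : forall i, (i < n)%N -> 0 < X i.

Ltac par_lia := rewrite /par /B; case: (inF_bounds tF) => ? ? ? ?;
  clear tF eX X0 par B; move: r12 r1r2; rewrite /tpar /branch_par; case_ifs; intros; lia.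

Lemma eigen_root : a * X 0%N = X 1%N + X h.+1 + X B.+1.
Proof.
have [h2 q12 q22 nE] := inF_bounds tF.
apply: (tree_eigen_root eX).
- by rewrite /B; split; lia.
- by split; par_lia.
- by rewrite /B; split; lia.
move=> j j0n; rewrite /par /tpar /branch_par -/B; case: ifP.
  by move=> /or3P [] /eqP -> _; [constructor 1|constructor 2|constructor 3].
by rewrite /B; case_ifs; lia.
Qed.

Lemma par_path i : [|| 0 < i < h, h < i < h + q1 | B < i < B + q2]%N -> par i.+1 = i.
Proof. by par_lia. Qed.

Lemma par_pred i : [|| 1 < i <= h, h.+1 < i <= h + q1 | B.+1 < i <= B + q2]%N ->
  par i = i.-1.
Proof. by par_lia. Qed.

Lemma eigen_path i : [|| 0 < i < h, h < i < h + q1 | B < i < B + q2]%N ->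
  a * X i = X (par i) + X i.+1.
Proof.
have [h2 q12 q22 nE] := inF_bounds tF => ir.
apply: (tree_eigen_child eX); [move: ir; rewrite /B; lia .. | exact: par_path |].
by move=> j; move: ir; par_lia.
Qed.

Lemma eigen_leaf : a * X h = X h.-1.
Proof.
have -> : h.-1 = par h by par_lia.
have [h2 q12 q22 nE] := inF_bounds tF.
by apply: (tree_eigen_leaf eX); [lia | move=> j; par_lia].
Qed.

Lemma eigen_v1 : (a ^+ 2 - 1) * (a * X (h + q1)%N - X (h + q1).-1) =
  r1%:R * a * X (h + q1)%N.
Proof.
have -> : (h + q1).-1 = par (h + q1) by par_lia.
have [h2 q12 q22 nE] := inF_bounds tF.
by apply: (tree_eigen_broom eX); [lia | lia | move=> j; par_lia
  | move=> j; par_lia | move=> j i; par_lia].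
Qed.

Lemma eigen_v2 : (a ^+ 2 - 1) * (a * X (B + q2)%N - X (B + q2).-1) =
  r2%:R * a * X (B + q2)%N.
Proof.
have -> : (B + q2).-1 = par (B + q2) by par_lia.
have [h2 q12 q22 nE] := inF_bounds tF.
by apply: (tree_eigen_broom eX); [rewrite /B; lia | rewrite /B; lia | move=> j; par_lia
  | move=> j; par_lia | move=> j i; par_lia].
Qed.

Lemma par0 : [/\ par 1 = 0%N, par h.+1 = 0%N & par B.+1 = 0%N].
Proof. by split; par_lia. Qed.

(** As [q2 >= 2], the vertex [v2] is the centre of a spider with [r2 + 1] legs of two edges, for
    which [a^2 - 1] would equal [r2 + 1]. The leg towards the root contributes at least as much as a
    pendant one because its second vertex has a further neighbour. *)
Lemma eigen_bound : 0 < a /\ r2%:R + 1 <= a ^+ 2 - 1.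
Proof.
have [h2 q12 q22 nE] := inF_bounds tF.
have rp : rooted n par by exact: tpar_rooted.
have xh : 0 < X h by apply: X0; lia.
have xh1 : 0 < X h.-1 by apply: X0; lia.
have a0 : 0 < a by have := xh1; rewrite -eigen_leaf pmulr_lgt0.
split=> //.
have d0 : 0 < a ^+ 2 - 1.
  have e : a * X h.-1 = X (par h.-1) + X h.
    by rewrite -[in X h](prednK (n := h)); [apply: eigen_path | ]; lia.
  have p0 : 0 < X (par h.-1).
    by apply: X0; apply: rooted_lt rp _ _; lia.
  rewrite subr_gt0 -(ltr_pM2r xh) mul1r expr2 -mulrA eigen_leaf e.
  by rewrite ltrDr.
have xv : 0 < X (B + q2)%N by apply: X0; rewrite /B; lia.
have ev := eigen_v2; have := eigen_path (i := (B + q2).-1).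
rewrite prednK; last by lia.
move=> /(_ ltac:(lia)) ep.
have pg : X (B + q2).-1 <= a * X (par (B + q2).-1).
  by apply: (tree_eigen_par_ge eX) => //; rewrite /B; lia.
rewrite -(ler_pM2r (mulr_gt0 a0 xv)).
have -> : (a ^+ 2 - 1) * (a * X (B + q2)%N) =
  r2%:R * (a * X (B + q2)%N) + (a ^+ 2 - 1) * X (B + q2).-1.
  by rewrite [r2%:R * _]mulrA -ev; ring.
rewrite mulrDl mul1r lerD2l.
have -> : (a ^+ 2 - 1) * X (B + q2).-1 = a * (a * X (B + q2).-1) - X (B + q2).-1 by ring.
by rewrite ep mulrDr; lra.
Qed.

Lemma eigen_sqr_ge5 : 5 <= a ^+ 2.
Proof.
have [_ b] := eigen_bound; have : 3 <= r2%:R :> R by rewrite (ler_nat R 3); lia.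
by move=> ?; lra.
Qed.

Lemma eigen_gt2 : 2 < a.
Proof. by have [a0 _] := eigen_bound; have a5 := eigen_sqr_ge5; nra. Qed.

(** At the leaf the ratio is [1 / a], and [k a >= 1 + k^2 > 1] puts it below [k]. The bound serves
    both for [k = s] and for [k = 7/10]. *)
Lemma pendant_ratio (k : R) : 0 < k -> 1 <= k * (a - k) -> X 1%N < k * X 0%N.
Proof.
move=> k0 ka; have [h2 q12 q22 nE] := inF_bounds tF.
have [p1 _ _] := par0; rewrite -[in X 0%N]p1.
apply: (@path_ratio_lt _ par a X k 1 h) => //; try lia.
- by move=> i ir; apply: par_path; lia.
- by move=> i ir; apply: eigen_path; lia.
- by move=> i ir; apply: X0; lia.
have xh : 0 < X h by apply: X0; lia.
have -> : par h = h.-1 by apply: par_pred; lia.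
rewrite -eigen_leaf mulrA ltr_pMl //; nra.
Qed.

(** The brooms at [v1] and [v2], with at least two pendant paths each, start the recursion at or
    above its fixed point [s], where it stays up to the root. *)
Lemma branch_ratio (s : R) : 0 < s -> s < 1 -> s * (a - s) = 1 ->
  s * X 0%N <= X h.+1 /\ s * X 0%N <= X B.+1.
Proof.
move=> s0 s1 sa; have [h2 q12 q22 nE] := inF_bounds tF.
have a2 := eigen_gt2; have [_ p1 p2] := par0.
split; [rewrite -[in X 0%N]p1 | rewrite -[in X 0%N]p2].
  apply: (@path_ratio_ge _ par a X s h.+1 (h + q1)) => //; try lia; try by rewrite sa.
  - by move=> i ir; apply: par_path; lia.
  - by move=> i ir; apply: eigen_path; lia.
  - by move=> i ir; apply: X0; lia.
  have -> : par (h + q1) = (h + q1).-1 by apply: par_pred; lia.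
  apply: broom_ratio_ge s0 s1 sa _ _ eigen_v1; [lra | by rewrite (ler_nat R 2) |].
  by apply: X0; lia.
apply: (@path_ratio_ge _ par a X s B.+1 (B + q2)) => //; try lia; try by rewrite sa.
- by move=> i ir; apply: par_path; lia.
- by move=> i ir; apply: eigen_path; lia.
- by move=> i ir; apply: X0; rewrite /B in ir *; lia.
have -> : par (B + q2) = (B + q2).-1 by apply: par_pred; lia.
apply: broom_ratio_ge s0 s1 sa _ _ eigen_v2; [lra | rewrite (ler_nat R 2); lia |].
by apply: X0; rewrite /B; lia.
Qed.

(** The first factor is below [s * X 0]. The second is [a * X 0 - X d], at most [(a - s) * X 0]; and
    [s (a - s) = 1]. *)
Lemma pendant_product_lt d e : a * X 0%N = X 1%N + X d + X e -> 0 < X d -> 0 < X e ->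
  (forall s, 0 < s -> s < 1 -> s * (a - s) = 1 -> s * X 0%N <= X d) ->
  X 1%N * (X 1%N + X e) < X 0%N ^+ 2.
Proof.
move=> er xd xe sd; have [s [s0 s1 sa]] := small_root eigen_gt2.
have xr : 0 < X 0%N by have [h2 q12 q22 nE] := inF_bounds tF; apply: X0; lia.
have x1 : X 1%N < s * X 0%N by apply: pendant_ratio; rewrite ?sa.
have -> : X 1%N + X e = a * X 0%N - X d by rewrite er; ring.
have le : a * X 0%N - X d <= (a - s) * X 0%N by rewrite mulrBl lerD2l lerN2; exact: sd.
have x10 : 0 < X 1%N by have [h2 q12 q22 nE] := inF_bounds tF; apply: X0; clear -h2 nE; lia.
have y0 : 0 < a * X 0%N - X d by rewrite er addrAC addrK addr_gt0.
have -> : X 0%N ^+ 2 = (s * X 0%N) * ((a - s) * X 0%N).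
  by rewrite mulrACA sa mul1r expr2.
apply: lt_le_trans (_ : s * X 0%N * (a * X 0%N - X d) <= _); first by rewrite ltr_pM2r.
by rewrite ler_pM2l // mulr_gt0.
Qed.

(* [r1 < r2] makes [a] large enough compared with the degree of [v1] for the
   entries to decay from [u] towards [v1]; [3 <= q1] leaves room for this decay. *)
Lemma branch1_ratio : (3 <= q1)%N -> X h.+1 < 7 / 10 * X 0%N.
Proof.
move=> q13; have [h2 q12 q22 nE] := inF_bounds tF.
have [_ p1 _] := par0.
have e1 := eigen_v1.
have e2 := eigen_path (i := (h + q1).-1) ltac:(lia).
have e3 := eigen_path (i := (h + q1).-2) ltac:(lia).
have pp : par (h + q1).-1 = (h + q1).-2 by apply: par_pred; lia.
have E1 : (h + q1).-1.+1 = (h + q1)%N by lia.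
have E2 : (h + q1).-2.+1 = (h + q1).-1 by lia.
rewrite pp E1 in e2; rewrite E2 in e3.
have x0 : 0 < X (h + q1)%N by apply: X0; lia.
have y0 : 0 < X (h + q1).-1 by apply: X0; lia.
have z0 : 0 < X (h + q1).-2 by apply: X0; lia.
have rr : r1%:R + 1 <= r2%:R :> R.
  by rewrite -[X in _ + X]/(1%:R) -natrD ler_nat addn1.
have [_ ab] := eigen_bound.
have k1 : X (h + q1).-2 < 7 / 10 * X (par (h + q1).-2).
  apply: broom_ratio_lt e1 e2 e3 => //.
  - exact: eigen_gt2.
  - exact: eigen_sqr_ge5.
  - by apply: le_trans ab; rewrite -[2]/(1 + 1) addrA lerD2r.
rewrite -[in X 0%N]p1.
apply: (@path_ratio_lt _ par a X (7 / 10) h.+1 (h + q1).-2) => //.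
- by rewrite divr_gt0.
- exact: decay_rate eigen_gt2 eigen_sqr_ge5.
- by move=> i ir; apply: par_path; clear -ir; lia.
- by move=> i ir; apply: eigen_path; clear -ir; lia.
- by move=> i ir; apply: X0; clear -ir nE; lia.
- by clear -q13; lia.
Qed.

Lemma branch1_product_lt : (3 <= q1)%N -> X h.+1 * (X h.+1 + X 1%N) < X 0%N ^+ 2.
Proof.
move=> q13; have [h2 q12 q22 nE] := inF_bounds tF.
have xr : 0 < X 0%N by apply: X0; lia.
have xh0 : 0 < X h.+1 by apply: X0; lia.
have x10 : 0 < X 1%N by apply: X0; lia.
have xh := branch1_ratio q13.
have x1 : X 1%N < 7 / 10 * X 0%N.
  by apply: pendant_ratio; [rewrite divr_gt0 | exact: decay_rate eigen_gt2 eigen_sqr_ge5].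
by apply: ratio_product_lt.
Qed.

End Ratios.

(** * Decrease of the spectral radius under each move *)

Section RhoMoves.
Variables (R : realType) (n r1 r2 h q1 q2 : nat).
Hypothesis r12 : (2 <= r1)%N.
Hypothesis r1r2 : (r1 < r2)%N.
Hypothesis tF : inF n r1 r2 (h, q1, q2).

Let n0 : (0 < n)%N. Proof. by have [] := inF_bounds tF; lia. Qed.

Lemma rho_alpha : (3 <= h)%N ->
  rho R (tree_graph n r1 r2 (alpha (h, q1, q2))) < rho R (tree_graph n r1 r2 (h, q1, q2)).
Proof.
have [h2 q12 q22 nE] := inF_bounds tF => h3.
rewrite -(isomorphic_rho R (iso_alpha tF h3)) (tree_graphE tF).
have [X eX X0] := tree_perron R n0 (@tpar_rooted n r1 (h, q1, q2)).
have er := eigen_root r12 r1r2 tF eX; have [p1 _ _] := par0 r12 r1r2 tF.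
apply: (switch_rho_lt (switchable_alpha tF) _ erefl eX X0 er); first by lia.
  by rewrite -[in X 0%N]p1; apply: (eigen_path r12 r1r2 tF eX); lia.
apply: (pendant_product_lt r12 r1r2 tF eX X0 er); try (apply: X0; lia).
by move=> s s0 s1 sa; have [] := branch_ratio r12 r1r2 tF eX X0 s0 s1 sa.
Qed.

Lemma rho_gamma : (3 <= h)%N ->
  rho R (tree_graph n r1 r2 (gamma (h, q1, q2))) < rho R (tree_graph n r1 r2 (h, q1, q2)).
Proof.
have [h2 q12 q22 nE] := inF_bounds tF => h3.
rewrite -(isomorphic_rho R (iso_gamma tF h3)) (tree_graphE tF).
have [X eX X0] := tree_perron R n0 (@tpar_rooted n r1 (h, q1, q2)).
have er := eigen_root r12 r1r2 tF eX; have [p1 _ _] := par0 r12 r1r2 tF.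
(* The root equation is put in the order [c], [d], [e]: for [gamma] the moved child is [B.+1] and
   the third one [h.+1]. *)
rewrite addrAC in er.
apply: (switch_rho_lt (switchable_gamma tF) _ erefl eX X0 er); first by lia.
  by rewrite -[in X 0%N]p1; apply: (eigen_path r12 r1r2 tF eX); lia.
apply: (pendant_product_lt r12 r1r2 tF eX X0 er); try (apply: X0; lia).
by move=> s s0 s1 sa; have [] := branch_ratio r12 r1r2 tF eX X0 s0 s1 sa.
Qed.

Lemma rho_beta : (3 <= q1)%N ->
  rho R (tree_graph n r1 r2 (beta (h, q1, q2))) < rho R (tree_graph n r1 r2 (h, q1, q2)).
Proof.
have [h2 q12 q22 nE] := inF_bounds tF => h3.
rewrite -(isomorphic_rho R (iso_beta tF h3)) (tree_graphE tF).
have [X eX X0] := tree_perron R n0 (@tpar_rooted n r1 (h, q1, q2)).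
have er := eigen_root r12 r1r2 tF eX; have [_ p1 _] := par0 r12 r1r2 tF.
(* For [beta] the order is [c = h.+1], [d = B.+1], [e = 1]. *)
rewrite -addrA addrC in er.
apply: (switch_rho_lt (switchable_beta tF) _ erefl eX X0 er); first by lia.
  by rewrite -[in X 0%N]p1; apply: (eigen_path r12 r1r2 tF eX); lia.
exact: (branch1_product_lt r12 r1r2 tF eX X0).
Qed.

End RhoMoves.

Unset Implicit Arguments.

Theorem theorem5p2 (R : realType) (r1 r2 n : nat) :
  (2 <= r1)%N -> (r1 < r2)%N ->
  (2 <= n - 5 - 2 * (r1 + r2))%N ->
  let Tstar := (n - 5 - 2 * (r1 + r2), 2, 2)%N in
  (* (a) *)
  (forall T, inF n r1 r2 T ->
     (dom_alpha T -> obtained_by_2switch (tree_graph n r1 r2 T) (tree_graph n r1 r2 (alpha T))) /\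
     (dom_beta T -> obtained_by_2switch (tree_graph n r1 r2 T) (tree_graph n r1 r2 (beta T))) /\
     (dom_gamma T -> obtained_by_2switch (tree_graph n r1 r2 T) (tree_graph n r1 r2 (gamma T)))) /\
  (* (b) *)
  (forall T, inF n r1 r2 T ->
     (dom_alpha T -> rho R (tree_graph n r1 r2 (alpha T)) < rho R (tree_graph n r1 r2 T)) /\
     (dom_beta T -> rho R (tree_graph n r1 r2 (beta T)) < rho R (tree_graph n r1 r2 T)) /\
     (dom_gamma T -> rho R (tree_graph n r1 r2 (gamma T)) < rho R (tree_graph n r1 r2 T))) /\
  (* (c) *)
  (forall T, inF n r1 r2 T -> clos_refl_trans _ step_ab Tstar T) /\
  (* (d) *)
  (forall T, inF n r1 r2 T -> clos_refl_trans _ step_ag Tstar T).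
Proof.
move=> r12 r1r2 _ Tstar; split; [|split; [|split]].
- move=> [[h q1] q2] tF; split; [|split] => d.
  + exact: switch_obtained tF (switchable_alpha tF) (iso_alpha tF d).
  + exact: switch_obtained tF (switchable_beta tF) (iso_beta tF d).
  + exact: switch_obtained tF (switchable_gamma tF) (iso_gamma tF d).
- move=> [[h q1] q2] tF; split; [|split] => d.
  + exact: rho_alpha.
  + exact: rho_beta.
  + exact: rho_gamma.
- by move=> T; exact: reach_ab.
- by move=> T; exact: reach_ag.
Qed.
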